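(* Let $p$ be a prime, $q=p^r$ with $r\geq1$, and $L:\mathbb{F}_q\to\mathbb{F}_q$ a linear function. Let $k>1$ be an integer and $D=p^{\lfloor\log_p(k)\rfloor+1}$. For $\beta\in\mathbb{F}_q$ let $\mathbbm{p}^{(q)}_{n,k}(\beta;L)=\frac{1}{q^n}\left|\{\mathbf{x}\in\mathbb{F}_q^n: L(\boldsymbol{e}_k(\mathbf{x}))=\beta\}\right|$ and $\mathrm{G}^{(q)}_{n,k}(L;X)=\sum_{\beta\in\mathbb{F}_q}\mathbbm{p}^{(q)}_{n,k}(\beta;L)X^\beta$. Then \[ \lim_{n\to\infty}\mathrm{G}^{(q)}_{n,k}(L;X)=\frac{1}{D^{q-1}}\sum_{b_{q-1}=0}^{D-1}\cdots\sum_{b_1=0}^{D-1}X^{L\left(\Lambda_{\mathbb{F}_q^\times}(k,b_1,\ldots,b_{q-1})\right)}. \]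
   Context: $\boldsymbol{e}_k(\mathbf{x})$ is the elementary symmetric polynomial of degree $k$ evaluated at $\mathbf{x}\in\mathbb{F}_q^n$. $X$ is a formal symbol: expressions $\sum_{\beta\in\mathbb{F}_q}c_\beta X^\beta$ are elements of the group algebra of $(\mathbb{F}_q,+)$ over $\mathbb{R}$, and the limit is taken coefficientwise (so the claim says each $\mathbbm{p}^{(q)}_{n,k}(\beta;L)$ converges to the coefficient of $X^\beta$ on the right, after collecting equal exponents). Fix an enumeration $\mathbb{F}_q^\times=\{\alpha_1,\ldots,\alpha_{q-1}\}$; $\Lambda_{\mathbb{F}_q^\times}(k,b_1,\ldots,b_{q-1})$ is the value of $\boldsymbol{e}_k$ at a vector in which each $\alpha_i$ appears exactly $b_i$ times (other entries $0$). *)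

(* Defs.v *)
From HB Require Import structures.
From mathcomp Require Import all_boot all_order all_algebra.
From mathcomp Require Import all_classical all_reals all_analysis.
From mathcomp Require Import (canonicals, coercions) mpoly.

Set Implicit Arguments.
Unset Strict Implicit.
Unset Printing Implicit Defensive.

Import Order.TTheory GRing.Theory Num.Theory.
Import numFieldNormedType.Exports.

Local Open Scope classical_set_scope.
Local Open Scope ring_scope.

(* The notations of [mpoly] are not imported, as they clash with those of
   MathComp-Analysis. *)
Definition esymval (F : comNzRingType) (k n : nat) (v : 'I_n -> F) : F :=
  mpoly.meval v (mpoly.mesym n F k).

(* Linearity over the prime field; the scalar c : 'F_p acts on F as c%:R,
   where c is read as a natural number below p. In particular every map that
   is linear over F itself satisfies this. *)
Definition prime_linear (p : nat) (F : finFieldType) (L : F -> F) : Prop :=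
  (forall x y : F, L (x + y) = L x + L y) /\
  (forall (c : 'F_p) (x : F), L ((c : nat)%:R * x) = (c : nat)%:R * L x).

Definition enumerates_units (F : finFieldType) (m : nat) (alpha : 'I_m -> F) :
  Prop := injective alpha /\ (forall x : F, (x != 0) <-> exists i, alpha i = x).

(* The word alpha_0 ... alpha_0 alpha_1 ... alpha_1 ..., with b_i copies of
   alpha_i. *)
Definition word_of (F : finFieldType) (m : nat) (alpha : 'I_m -> F)
    (b : 'I_m -> nat) : seq F :=
  flatten [seq nseq (b i) (alpha i) | i <- enum 'I_m].

(* The vector chosen here has no zero entries; by [LambdaE] below, every vector
   with the same multiplicities gives the same value. *)
Definition Lambda (F : finFieldType) (m : nat) (alpha : 'I_m -> F) (k : nat)
    (b : 'I_m -> nat) : F :=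
  esymval k (fun j : 'I_(size (word_of alpha b)) => (word_of alpha b)`_j).

(* The additive group of the group algebra R[(F, +)]: a formal sum
   \sum_beta c_beta X^beta is its coefficient function beta |-> c_beta. *)
Notation group_alg R F := {ffun F -> R^o}.

Definition formalX (R : realType) (F : finFieldType) (beta : F) :
  group_alg R F := [ffun g => (g == beta)%:R].

Definition coefwise_cvg (R : realType) (F : finFieldType)
    (u : nat -> group_alg R F) (l : group_alg R F) : Prop :=
  forall beta : F, (fun n => u n beta : R) @ \oo --> (l beta : R).

Definition pnk (R : realType) (F : finFieldType) (L : F -> F) (k n : nat)
    (beta : F) : R :=
  #|[set x : {ffun 'I_n -> F} | L (esymval k x) == beta]%SET|%:R
    / (#|F| ^ n)%:R.

Definition Gnk (R : realType) (F : finFieldType) (L : F -> F) (k n : nat) :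
  group_alg R F := \sum_(beta : F) pnk R L k n beta *: formalX R beta.

Section LambdaWellDefined.
Variable F : finFieldType.

Let g (x : F) : {poly F} := x *: 'X + 1.

Lemma esymval_coef (k n : nat) (v : 'I_n -> F) :
  esymval k v = (\prod_(j < n) g (v j))`_k.
Proof.
rewrite /g bigA_distr coef_sum /esymval /mpoly.mesym raddf_sum big_mkcond.
apply: eq_bigr => J _.
rewrite -big_mkcond scaler_prod prodr_const coefZ coefXn eq_sym.
case: eqP => _; last by rewrite mulr0.
rewrite mulr1 /= rmorph_prod; apply: eq_bigr => i _.
exact: mpoly.mevalXU.
Qed.

Lemma LambdaE (m k n : nat) (alpha : 'I_m -> F) (b : 'I_m -> nat)
    (v : 'I_n -> F) :
  enumerates_units alpha ->
  (forall i, #|[set j | v j == alpha i]%SET| = b i) ->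
  esymval k v = Lambda alpha k b.
Proof.
move=> [inja enua] hb; rewrite /Lambda !esymval_coef; congr ((polyseq _)`_k).
have -> : \prod_(j < size (word_of alpha b)) g ((word_of alpha b)`_j)
        = \prod_(x <- word_of alpha b) g x.
  by rewrite [RHS](big_nth 0) big_mkord.
rewrite /word_of big_flatten big_map big_enum /=.
have E (j : 'I_n) : g (v j) = \prod_(i | v j == alpha i) g (alpha i).
  have [vj0|/enua[i ij]] := eqVneq (v j) 0.
    rewrite big1 => [|i /eqP <-]; by rewrite vj0 /g scale0r add0r.
  rewrite (big_pred1 i) ?ij // => i'.
  by rewrite -ij (inj_eq inja) eq_sym.
rewrite (eq_bigr _ (fun j _ => E j)) (exchange_big_dep predT) //=.
transitivity (\prod_(i < m) g (alpha i) ^+ b i); apply: eq_bigr => i _.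
  rewrite prodr_const -hb; congr (_ ^+ _).
  by apply: eq_card => j; rewrite !inE.
by rewrite big_nseq iter_mulr_1.
Qed.

End LambdaWellDefined.

(* Main.v *)
Require Import Defs.
From mathcomp Require Import all_boot all_order all_algebra.
From mathcomp Require Import all_classical all_reals all_analysis.
From mathcomp Require Import finfield ring lra.
Import Order.TTheory GRing.Theory Num.Theory.
Import numFieldNormedType.Exports.
Local Open Scope ring_scope.

(** The value [e_k x] is the coefficient of [X^k] in the product of the
    [x_j X + 1].  In characteristic p, [(a X + 1)^D = a^D X^D + 1], and k < D, so
    [e_k x] depends only on the multiplicities of the [alpha_i] in x modulo D.
    For uniform x these multiplicities perform a random walk on [(Z/D)^(q-1)]
    whose steps are 0 (for [x_j = 0]) or a basis vector.  Every element is
    reached with positive probability after a fixed number N of steps, so by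
    Doeblin's argument the walk becomes uniformly distributed. *)

(* As [u n - 1/|H|] has sum 0, convolving it with [u N] is the same as
   convolving it with [u N - eps], which is nonnegative of mass
   [1 - eps * |H|]. *)
Lemma convolution_contraction {R : realType} {H : finZmodType}
    (u : nat -> H -> R) (N : nat) (eps : R) :
  (forall n h, 0 <= u n h) -> (forall n, \sum_h u n h = 1) ->
  (forall m n h, u (m + n)%N h = \sum_g u m g * u n (h - g)) ->
  (forall h, eps <= u N h) ->
  forall m n h, (m * N <= n)%N ->
    `|u n h - #|H|%:R^-1| <= (1 - eps *+ #|H|) ^+ m.
Proof.
move=> u_ge0 u_sum u_add u_eps.
have cardH : #|H|%:R != 0 :> R.
  by rewrite pnatr_eq0 -lt0n; apply/card_gt0P; exists 0.
have u_le1 n h : u n h <= 1.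
  by rewrite -(u_sum n) (bigD1 h) //= lerDl sumr_ge0.
have sumB n h : \sum_g u n (h - g) = 1.
  rewrite -(u_sum n) [RHS](reindex_inj (inj_comp (addrI h) oppr_inj)).
  by apply: eq_bigr.
elim=> [|m IHm] n h le_mn.
  have c0 : 0 <= #|H|%:R^-1 :> R by rewrite invr_ge0.
  have c1 : #|H|%:R^-1 <= 1 :> R.
    by rewrite invf_le1 ?ltr0n ?ler1n lt0n -(pnatr_eq0 R).
  have := u_ge0 n h; have := u_le1 n h; rewrite expr0 ler_norml.
  by move=> *; apply/andP; split; lra.
have -> : n = (N + (n - N))%N by rewrite subnKC // (leq_trans _ le_mn) // leq_addr.
set n' := (n - N)%N.
have -> : u (N + n')%N h - #|H|%:R^-1 =
    \sum_g (u N g - eps) * (u n' (h - g) - #|H|%:R^-1).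
  rewrite u_add; under [RHS]eq_bigr do rewrite mulrBl !mulrBr opprB.
  rewrite !big_split /= !sumrN -!mulr_suml -!mulr_sumr u_sum sumB mul1r mulr1.
  by rewrite sumr_const -[eps *+ _]mulr_natr mulfK // subrr addr0.
have rhoE : 1 - eps *+ #|H| = \sum_g (u N g - eps).
  by rewrite big_split /= u_sum sumr_const mulNrn.
rewrite exprS {1}rhoE mulr_suml; apply: (le_trans (ler_norm_sum _ _ _)).
apply: ler_sum => g _; rewrite normrM ger0_norm ?subr_ge0 //; apply: ler_wpM2l; rewrite ?subr_ge0 //.
by apply: IHm; rewrite leq_subRL ?(leq_trans _ le_mn) ?mulSn // leq_addr.
Qed.

(** The ratio [1 - eps *+ #|H|] is nonnegative because [u N] has mass 1 and dominates [eps], and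
    below 1 because [eps > 0]; hence the contraction bound decays geometrically. *)
Lemma convolution_cvg_uniform {R : realType} {H : finZmodType}
    (u : nat -> H -> R) (N : nat) (eps : R) :
  (forall n h, 0 <= u n h) -> (forall n, \sum_h u n h = 1) ->
  (forall m n h, u (m + n)%N h = \sum_g u m g * u n (h - g)) ->
  0 < eps -> (forall h, eps <= u N h) ->
  forall h, (u n h @[n --> \oo] --> (#|H|%:R^-1 : R))%classic.
Proof.
move=> u_ge0 u_sum u_add eps0 u_eps h.
have rho0 : 0 <= 1 - eps *+ #|H|.
  by rewrite -(u_sum N) -sumr_const -sumrB sumr_ge0 // => g _; rewrite subr_ge0.
have rho1 : `|1 - eps *+ #|H| | < 1.
  rewrite ger0_norm // gtrBl pmulrn_lgt0 //.
  by apply/card_gt0P; exists 0.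
apply/cvgrPdist_le => e e0.
have /cvgrPdist_le/(_ e e0)[m _ /(_ m (leqnn m))] := cvg_expr rho1.
rewrite /= sub0r normrN ger0_norm ?exprn_ge0 // => rhom.
exists (m * N)%N => // n /= le_mn; rewrite distrC.
by apply: le_trans rhom; apply: convolution_contraction le_mn.
Qed.

(** * Random walks on a finite abelian group *)

(** The law at time n of the walk from 0 with steps [s (x j)], the letters being independent and
    uniform in [F]. *)
Definition walk (R : realType) {F : finType} {H : finZmodType} (s : F -> H)
    (n : nat) (h : H) : R :=
  (\sum_(x : {ffun 'I_n -> F}) (\sum_j s (x j) == h)%:R) / (#|F| ^ n)%:R.

(** Each word ends at a single h. With [A] full this gives total mass 1; with [A] a fibre it gives
    the probabilities in the theorem. *)
Lemma sum_walk {R : realType} {F : finType} {H : finZmodType} (s : F -> H)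
    (n : nat) (A : pred H) :
  \sum_(h | A h) walk R s n h =
  #|[set x : {ffun 'I_n -> F} | A (\sum_j s (x j))]%SET|%:R / (#|F| ^ n)%:R.
Proof.
rewrite -mulr_suml exchange_big /=; congr (_ / _).
rewrite -sum1_card natr_sum [RHS]big_mkcond.
apply: eq_bigr => x _.
rewrite inE; case: ifPn => Ax.
  rewrite (bigD1 (\sum_j s (x j))) //= eqxx big1 ?addr0 // => h /andP[_ /negPf].
  by rewrite eq_sym => ->.
by rewrite big1 // => h Ah; case: eqP => // xh; rewrite xh Ah in Ax.
Qed.

(** A word of length m + n is a pair of words of lengths m and n, and its endpoint is the sum of
    theirs. *)
Lemma walk_add {R : realType} {F : finType} {H : finZmodType} (s : F -> H)
    (m n : nat) (h : H) :
  walk R s (m + n) h = \sum_g walk R s m g * walk R s n (h - g).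
Proof.
pose cat (uv : {ffun 'I_m -> F} * {ffun 'I_n -> F}) : {ffun 'I_(m + n) -> F} :=
  [ffun j => match fintype.split j with inl i => uv.1 i | inr i => uv.2 i end].
have cat_bij : bijective cat.
  exists (fun x : {ffun _ -> F} =>
    ([ffun i => x (lshift n i)], [ffun i => x (rshift m i)])).
    move=> [a b]; congr pair; apply/ffunP => i; rewrite !ffunE.
      by rewrite (unsplitK (inl i)).
    by rewrite (unsplitK (inr i)).
  move=> x; apply/ffunP => j; rewrite ffunE -[in RHS](splitK j).
  by case: fintype.split => i; rewrite /= ffunE.
have cat_sum uv : \sum_j s (cat uv j) = \sum_j s (uv.1 j) + \sum_j s (uv.2 j).
  rewrite big_split_ord /=; congr (_ + _); apply: eq_bigr => i _; rewrite ffunE.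
    by rewrite (unsplitK (inl i)).
  by rewrite (unsplitK (inr i)).
rewrite /walk (reindex cat) /=; last exact: onW_bij.
under [RHS]eq_bigr do rewrite mulrACA -invfM -natrM -expnD.
rewrite -mulr_suml; congr (_ / _).
under eq_bigr do rewrite cat_sum.
rewrite -(pair_bigA _ (fun (a : {ffun _ -> F}) (b : {ffun _ -> F}) =>
  (\sum_j s (a j) + \sum_j s (b j) == h)%:R)) /=.
under [RHS]eq_bigr do rewrite mulr_suml.
rewrite [RHS]exchange_big /=; apply: eq_bigr => a _.
rewrite [RHS](bigD1 (\sum_j s (a j))) //= eqxx mul1r.
rewrite [X in _ = _ + X]big1 ?addr0 => [|g /negPf]; last first.
  by rewrite eq_sym => ->; rewrite mul0r.
by apply: eq_bigr => b _; rewrite [in RHS]eq_sym subr_eq addrC eq_sym.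
Qed.

Lemma walk_cvg_uniform {R : realType} {F : finType} {H : finZmodType}
    (s : F -> H) (N : nat) :
  (0 < #|F|)%N ->
  (forall h, exists x : {ffun 'I_N -> F}, \sum_j s (x j) = h) ->
  forall h, (walk R s n h @[n --> \oo] --> (#|H|%:R^-1 : R))%classic.
Proof.
move=> F0 surj.
have qn0 n : 0 < (#|F| ^ n)%:R :> R by rewrite ltr0n expn_gt0 F0.
(* Every h is the endpoint of at least one of the [#|F| ^ N] equally likely words, whence this lower
   bound. *)
apply: (@convolution_cvg_uniform _ _ _ N (#|F| ^ N)%:R^-1).
- by move=> n h; rewrite divr_ge0 ?ler0n // sumr_ge0.
- move=> n; rewrite sum_walk (_ : [set x | _]%SET = [set: _]%SET).
    by rewrite cardsT card_ffun card_ord divff ?gt_eqF.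
  by apply/setP => x; rewrite !inE.
- by move=> m n h; exact: walk_add.
- by rewrite invr_gt0.
move=> h; have [x xh] := surj h; rewrite -[leLHS]mul1r ler_wpM2r ?invr_ge0 ?ler0n //.
by rewrite (bigD1 x) //= xh eqxx lerDl sumr_ge0.
Qed.

(** * Periodicity of [Lambda] in the multiplicities *)

(** By Frobenius each full block of D factors is 1 modulo X^D, so only the remainder of n counts. *)
Lemma affine_pow_mod {F : comNzRingType} (p D n : nat) (a : F) :
  p \in GRing.pchar F -> p.-nat D ->
  exists Q : {poly F},
    (a *: 'X + 1) ^+ n = (a *: 'X + 1) ^+ (n %% D) + Q * 'X^D.
Proof.
move=> charF pD.
have frob : (a *: 'X + 1) ^+ D = 1 + (a ^+ D)%:P * 'X^D :> {poly F}.
  rewrite exprDn_pchar; last first.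
    apply: sub_in_pnat pD => p' _ /eqP ->; rewrite pchar_poly; exact: charF.
  by rewrite expr1n addrC exprZn mul_polyC.
have [Q QE] : exists Q, ((a *: 'X + 1) ^+ D) ^+ (n %/ D) = 1 + Q * 'X^D :> {poly F}.
  elim: (n %/ D)%N => [|d [Q QE]]; first by exists 0; rewrite mul0r addr0.
  exists ((a ^+ D)%:P * (1 + Q * 'X^D) + Q).
  by rewrite exprS QE frob; ring.
exists (Q * (a *: 'X + 1) ^+ (n %% D)).
by rewrite {1}(divn_eq n D) exprD mulnC exprM QE; ring.
Qed.

Lemma Lambda_coef {F : finFieldType} {m : nat} (alpha : 'I_m -> F) (k : nat)
    (b : 'I_m -> nat) :
  Lambda alpha k b = (\prod_i (alpha i *: 'X + 1) ^+ b i)`_k.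
Proof.
rewrite /Lambda esymval_coef; congr ((polyseq _)`_k).
rewrite -[LHS](big_mkord predT (fun j => (word_of alpha b)`_j *: 'X + 1)).
rewrite -(big_nth 0 predT (fun x => x *: 'X + 1)) /word_of big_flatten big_map.
by rewrite big_enum /=; apply: eq_bigr => i _; rewrite big_nseq iter_mulr_1.
Qed.

Lemma Lambda_mod {F : finFieldType} {m : nat} (p D k : nat) (alpha : 'I_m -> F)
    (b : 'I_m -> nat) :
  p \in GRing.pchar F -> p.-nat D -> (k < D)%N ->
  Lambda alpha k b = Lambda alpha k (fun i => (b i %% D)%N).
Proof.
move=> charF pD kD; rewrite !Lambda_coef.
suff [Q ->] : exists Q, \prod_i (alpha i *: 'X + 1) ^+ b i =
    \prod_i (alpha i *: 'X + 1) ^+ (b i %% D) + Q * 'X^D :> {poly F}.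
  by rewrite coefD coefMXn kD addr0.
elim/big_ind2: _ => [|P P1 Q Q1 [S ->] [T ->]|i _].
- by exists 0; rewrite mul0r addr0.
(* The cofactor of X^D in (P + S X^D)(Q + T X^D). *)
- by exists (S * Q + P * T + S * T * 'X^D); ring.
exact: affine_pow_mod charF pD.
Qed.

(** * The walk of multiplicities modulo D *)

(** The modulus D is written [d.+2] so that ['I_d.+2] is the ring Z/D. *)
Definition unit_step {F : finFieldType} {m : nat} (alpha : 'I_m -> F) (d : nat)
    (x : F) : 'rV['I_d.+2]_m :=
  \row_i (x == alpha i)%:R.

Lemma sum_unit_step {F : finFieldType} {m : nat} (alpha : 'I_m -> F) (d n : nat)
    (x : 'I_n -> F) (i : 'I_m) :
  nat_of_ord ((\sum_j unit_step alpha d (x j)) 0 i) =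
  (#|[set j | x j == alpha i]%SET| %% d.+2)%N.
Proof.
rewrite summxE; under eq_bigr do rewrite mxE.
rewrite -natr_sum Zp_nat /=; congr (_ %% _)%N.
by rewrite -sum1_card [RHS]big_mkcond; apply: eq_bigr => j _; rewrite inE; case: eqP.
Qed.

Lemma unit_step_surj {F : finFieldType} {m : nat} (alpha : 'I_m -> F) (d : nat)
    (h : 'rV['I_d.+2]_m) :
  enumerates_units alpha ->
  exists x : {ffun 'I_(m * d.+2) -> F}, \sum_j unit_step alpha d (x j) = h.
Proof.
move=> [inja enua]; pose w := word_of alpha (fun i => nat_of_ord (h 0 i)).
(* Every multiplicity is below D, so one length suits all targets h. *)
have szw : (size w <= m * d.+2)%N.
  rewrite size_flatten /shape -map_comp sumnE big_map big_enum /=.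
  under eq_bigr do rewrite size_nseq.
  rewrite -[m in (m * _)%N]card_ord -sum_nat_const; apply: leq_sum => i _.
  exact: ltnW.
have s0 : unit_step alpha d 0 = 0.
  apply/rowP => i; rewrite !mxE; case: eqP => // a0.
  by have /enua : exists i', alpha i' = 0 by [exists i]; rewrite eqxx.
(* Beyond the end of [w] the default value 0 pads the word, and the letter 0 does not move the
   walk. *)
exists [ffun j : 'I_(m * d.+2) => w`_j].
under eq_bigr do rewrite ffunE.
rewrite -(big_mkord predT (fun j => unit_step alpha d w`_j)).
rewrite (big_cat_nat (leq0n _) szw) //=.
rewrite [X in _ + X]big_nat [X in _ + X]big1 ?addr0; last first.
  by move=> j /andP[le_wj _]; rewrite nth_default.
rewrite -(big_nth 0 predT (unit_step alpha d)) big_flatten big_map big_enum /=.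
apply/rowP => i; rewrite summxE (bigD1 i) //= [X in _ + X]big1 ?addr0 => [|i' ne_i'].
  by rewrite big_nseq iter_addr_0 mulmxnE mxE eqxx mulr1n Zp_nat valZpK.
rewrite big_nseq iter_addr_0 mulmxnE mxE (inj_eq inja) (negPf ne_i').
by rewrite mul0rn.
Qed.

Lemma esymval_unit_step {F : finFieldType} {m : nat} (p d k n : nat)
    (alpha : 'I_m -> F) (x : 'I_n -> F) :
  p \in GRing.pchar F -> p.-nat d.+2 -> (k < d.+2)%N ->
  enumerates_units alpha ->
  esymval k x = Lambda alpha k
    (fun i => nat_of_ord ((\sum_j unit_step alpha d (x j)) 0 i)).
Proof.
move=> charF pD kD enua; rewrite (LambdaE k enua (fun=> erefl)).
rewrite (Lambda_mod p d.+2) //; congr Lambda.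
by apply: funext => i; rewrite sum_unit_step.
Qed.

(** * Passage to the limit in each coefficient *)

Lemma GnkE {R : realType} {F : finFieldType} (L : F -> F) (k n : nat) (beta : F) :
  Gnk R L k n beta = pnk R L k n beta.
Proof.
rewrite /Gnk sum_ffunE (bigD1 beta) //= big1 ?addr0 => [|g ne_g].
  by rewrite !ffunE eqxx /GRing.scale /= mulr1.
by rewrite !ffunE eq_sym (negPf ne_g) scaler0.
Qed.

Theorem theorem3p1 (R : realType) (p r : nat) (F : finFieldType) (L : F -> F)
    (k : nat) (alpha : 'I_((p ^ r)%N.-1) -> F) :
  prime p -> (1 <= r)%N -> #|F| = (p ^ r)%N ->
  prime_linear p L ->
  enumerates_units alpha ->
  (1 < k)%N ->
  let q := (p ^ r)%N in
  let D := (p ^ (trunc_log p k).+1)%N in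
  coefwise_cvg (fun n => Gnk R L k n)
    ((((D ^ q.-1)%N)%:R^-1 : R) *:
      \sum_(b : {ffun 'I_q.-1 -> 'I_D})
        formalX R (L (Lambda alpha k (fun i => nat_of_ord (b i))))).
Proof.
move=> pr_p r_gt0 cardF _ enua k_gt1 q D beta.
have charF : p \in GRing.pchar F by apply: card_finPcharP cardF pr_p.
have pD : p.-nat D by rewrite pnatX pnat_id.
have kD : (k < D)%N by apply: trunc_log_ltn; apply: prime_gt1.
(* Since 1 < k < D, the modulus has the form [d.+2]. *)
move: (D) pD kD => {D} [|[|d]] pD kD; [by [] | by move: k_gt1 kD; case: (k) |].
pose Lam (h : 'rV['I_d.+2]_q.-1) :=
  L (Lambda alpha k (fun i => nat_of_ord (h 0 i))).
(* The coefficient at [beta] is the mass that the walk puts on the fibre of [Lam] over [beta]. *)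
have -> : (fun n => Gnk R L k n beta : R) =
    fun n => \sum_(h | Lam h == beta) walk R (unit_step alpha d) n h.
  apply: funext => n; rewrite GnkE (sum_walk _ _ (fun h => Lam h == beta)).
  congr (_%:R / _); apply: eq_card => x.
  by rewrite !inE (esymval_unit_step p d k _ alpha) //.
(* The claimed limit is the uniform mass of the same fibre, once tuples b are identified with row
   vectors. *)
have -> : (((d.+2 ^ q.-1)%N%:R^-1 : R) *:
      \sum_(b : {ffun 'I_q.-1 -> 'I_d.+2})
        formalX R (L (Lambda alpha k (fun i => nat_of_ord (b i))))) beta =
    \sum_(h | Lam h == beta) #|{: 'rV['I_d.+2]_q.-1}|%:R^-1 :> R.
  rewrite ffunE sum_ffunE card_mx mul1n card_ord.
  rewrite [RHS]big_mkcond /GRing.scale /= mulr_sumr.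
  rewrite (reindex (fun h : 'rV['I_d.+2]_q.-1 => [ffun i => h 0 i])) /=.
    apply: eq_bigr => h _; rewrite ffunE eq_sym.
    rewrite (_ : (fun i => _) = fun i => nat_of_ord (h 0 i)).
      by rewrite /Lam; case: eqP; rewrite ?mulr1 ?mulr0.
    by apply: funext => i; rewrite ffunE.
  apply: onW_bij; exists (fun b : {ffun 'I_q.-1 -> 'I_d.+2} => \row_i b i) => b.
    by apply/rowP => i; rewrite mxE ffunE.
  by apply/ffunP => i; rewrite ffunE mxE.
apply: cvg_big => [|h _]; first exact: add_continuous.
apply: walk_cvg_uniform => [|h']; last exact: unit_step_surj.
by rewrite cardF expn_gt0 prime_gt0.
Qed.
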